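(* Let $Id$ be the identity operator on $\mathcal{C}(I\times J,\mathbb{R})$, and let $\Delta$, $\alpha$, $L$ and the fractal operator $\mathcal{F}^{\alpha}_{\Delta,L}$ be as in the context. (1) For any $f\in\mathcal{C}(I\times J,\mathbb{R})$, $$\|f^{\alpha}_{\Delta,L}-f\|_\infty\le\frac{\|\alpha\|_\infty}{1-\|\alpha\|_\infty}\|f-Lf\|_\infty.$$ In particular, if $\alpha=0$ then $\mathcal{F}^{\alpha}_{\Delta,L}=Id$. (2) $\mathcal{F}^{\alpha}_{\Delta,L}$ is a bounded linear operator on $\mathcal{C}(I\times J,\mathbb{R})$ with respect to the uniform norm, and $$\|\mathcal{F}^{\alpha}_{\Delta,L}\|\le 1+\frac{\|\alpha\|_\infty\|Id-L\|}{1-\|\alpha\|_\infty}.$$ (3) If $\|\alpha\|_\infty<\|L\|^{-1}$, then $\mathcal{F}^{\alpha}_{\Delta,L}$ is bounded below; in particular it is one-to-one. (4) If $\|\alpha\|_\infty<(1+\|Id-L\|)^{-1}$, then $\mathcal{F}^{\alpha}_{\Delta,L}$ has a bounded inverse and consequently is a topological automorphism (a bijective bounded linear map with bounded inverse from $\mathcal{C}(I\times J,\mathbb{R})$ to itself). Moreover, $$\|(\mathcal{F}^{\alpha}_{\Delta,L})^{-1}\|\le\frac{1+\|\alpha\|_\infty}{1-\|\alpha\|_\infty\|L\|}.$$ (5) If $\|\alpha\|_\infty\neq0$, then every fixed point of $L$ is a fixed point of $\mathcal{F}^{\alpha}_{\Delta,L}$. (6) If $1$ belongs to the point spectrum of $L$,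 then $1\le\|\mathcal{F}^{\alpha}_{\Delta,L}\|$. (7) If $\|\alpha\|_\infty<\|L\|^{-1}$, then $\mathcal{F}^{\alpha}_{\Delta,L}$ is not a compact operator. (8) If $\|\alpha\|_\infty<(1+\|Id-L\|)^{-1}$, then $\mathcal{F}^{\alpha}_{\Delta,L}$ is Fredholm and its index is $0$.
   Context: Let $I=[x_0,x_N]$, $J=[y_0,y_M]$ and let $\Delta$ be a net $x_0<x_1<\dots<x_N$, $y_0<y_1<\dots<y_M$, with $N,M$ such that the maps below are contractive (i.e. $N,M\ge 2$). Put $I_i=[x_{i-1},x_i]$ and $J_j=[y_{j-1},y_j]$. For $1\le i\le N$, $u_i:I\to I_i$ is the affine bijection with $u_i(x_0)=x_{i-1}$, $u_i(x_N)=x_i$ if $i$ is odd, and $u_i(x_0)=x_i$, $u_i(x_N)=x_{i-1}$ if $i$ is even. For $1\le j\le M$, $v_j:J\to J_j$ is the affine bijection with $v_j(y_0)=y_{j-1}$, $v_j(y_M)=y_j$ if $j$ is odd, and $v_j(y_0)=y_j$, $v_j(y_M)=y_{j-1}$ if $j$ is even. $\mathcal{C}(I\times J,\mathbb{R})$ carries the uniform norm $\|\cdot\|_\infty$; operator norms are with respect to it. The scale function $\alpha:I\times J\to\mathbb{R}$ is continuous with $\|\alpha\|_\infty=\sup\{|\alpha(x,y)|:(x,y)\in I\times J\}<1$. $L:\mathcal{C}(I\times J,\mathbb{R})\to\mathcal{C}(I\times J,\mathbb{R})$ is a bounded linear operator, $L\neq Id$, with $(Lf)(x_i,y_j)=f(x_i,y_j)$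 for all $f$ and all $(i,j)\in\{0,N\}\times\{0,M\}$. For $f\in\mathcal{C}(I\times J,\mathbb{R})$, the (bivariate) $\alpha$-fractal function $f^{\alpha}_{\Delta,L}$ is the unique continuous function on $I\times J$ satisfying, for all $1\le i\le N$, $1\le j\le M$ and $(x,y)\in I_i\times J_j$, $$f^{\alpha}_{\Delta,L}(x,y)=f(x,y)+\alpha(x,y)f^{\alpha}_{\Delta,L}\big(u_i^{-1}(x),v_j^{-1}(y)\big)-\alpha(x,y)(Lf)\big(u_i^{-1}(x),v_j^{-1}(y)\big);$$ it agrees with $f$ at all $(x_i,y_j)$, $0\le i\le N$, $0\le j\le M$. The fractal operator is $\mathcal{F}^{\alpha}_{\Delta,L}:\mathcal{C}(I\times J,\mathbb{R})\to\mathcal{C}(I\times J,\mathbb{R})$, $\mathcal{F}^{\alpha}_{\Delta,L}(f)=f^{\alpha}_{\Delta,L}$. A bounded operator $T$ is Fredholm if its range is closed and $\ker T$, $\ker T^*$ are finite-dimensional ($T^*$ the adjoint on the dual space); its index is $\dim\ker T-\dim\ker T^*$. *)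

(* Defs.v *)
From HB Require Import structures.
From mathcomp Require Import all_boot all_order all_algebra.
From mathcomp Require Import all_classical all_reals all_analysis.

Set Implicit Arguments.
Unset Strict Implicit.
Unset Printing Implicit Defensive.

Import Order.TTheory GRing.Theory Num.Theory.
Import numFieldNormedType.Exports.

Local Open Scope classical_set_scope.
Local Open Scope ring_scope.

Section ContinuousFunctionsOnRectangle.
Context {R : realType}.
Implicit Types a b c d : R.

Definition rect a b c d : set (R * R) := `[a, b] `*` `[c, d].

Lemma rect_compact a b c d : compact (rect a b c d).
Proof. by apply: compact_setX; exact: segment_compact. Qed.

(* A continuous real function on the rectangle is represented by its extension
   by 0 to R * R, so that Leibniz equality is equality on the rectangle. *)
Definition crect_pred a b c d : {pred R * R -> R} :=
  [pred f | `[< {within rect a b c d, continuous f} /\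
                (forall p, ~ rect a b c d p -> f p = 0) >]].

Lemma crect_submod a b c d : submod_closed (crect_pred a b c d).
Proof.
split=> [|k f g]; rewrite !inE.
  by split=> // p; exact: cvg_cst.
move=> -[cf f0] -[cg g0]; split=> [p|p Kp].
  apply: cvgD; last exact: cg.
  by apply: cvgZ; [exact: cvg_cst | exact: cf].
by rewrite !fctE f0// g0// scaler0 addr0.
Qed.

HB.instance Definition _ a b c d :=
  GRing.isSubmodClosed.Build R (R * R -> R) (crect_pred a b c d)
    (crect_submod a b c d).

Record crect a b c d := CRect {
  crect_fun :> R * R -> R;
  _ : crect_fun \in crect_pred a b c d }.

HB.instance Definition _ a b c d := [isSub for @crect_fun a b c d].
HB.instance Definition _ a b c d := [Choice of crect a b c d by <:].
HB.instance Definition _ a b c d :=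
  [SubChoice_isSubZmodule of crect a b c d by <:].
HB.instance Definition _ a b c d :=
  [SubZmodule_isSubLmodule of crect a b c d by <:].

Definition uniform_norm a b c d (f : crect a b c d) : R :=
  sup [set `|f p| | p in rect a b c d].

Section norm_axioms.
Variables a b c d : R.
Implicit Types f g : crect a b c d.

Lemma crect_continuous f : {within rect a b c d, continuous f}.
Proof. by case: f => f /= /asboolP[]. Qed.

Lemma crect_out f p : ~ rect a b c d p -> f p = 0.
Proof. by case: f => f /= /asboolP[_]; exact. Qed.

Lemma crectP f g : (forall p, rect a b c d p -> f p = g p) -> f = g.
Proof.
move=> fg; apply/val_inj/funext => p /=.
by have [/fg//|Kp] := pselect (rect a b c d p); rewrite !crect_out.
Qed.

Lemma crect_has_ub f : has_ubound [set `|f p| | p in rect a b c d].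
Proof.
have /compact_bounded[M [_ fM]] : compact (f @` rect a b c d).
  by apply: continuous_compact; [exact: crect_continuous | exact: rect_compact].
exists (M + 1) => _ [p Kp <-].
by apply: (fM (M + 1)); [rewrite ltrDl | exists p].
Qed.

Lemma ler_uniform_norm f p : rect a b c d p -> `|f p| <= uniform_norm f.
Proof. by move=> Kp; apply: ub_le_sup; [exact: crect_has_ub | exists p]. Qed.

Lemma uniform_norm_ge0 f : 0 <= uniform_norm f.
Proof.
rewrite /uniform_norm.
have [->|/set0P[_ [p Kp _]]] := eqVneq [set `|f p| | p in rect a b c d] set0.
  by rewrite sup0.
by apply: (le_trans (normr_ge0 (f p))); exact: ler_uniform_norm.
Qed.

Lemma uniform_norm_le f M : 0 <= M ->
  (forall p, rect a b c d p -> `|f p| <= M) -> uniform_norm f <= M.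
Proof.
move=> M0 fM; rewrite /uniform_norm.
have [->|/set0P S0] := eqVneq [set `|f p| | p in rect a b c d] set0.
  by rewrite sup0.
by apply: ge_sup => // _ [p Kp <-]; exact: fM.
Qed.

Lemma uniform_normD f g :
  uniform_norm (f + g) <= uniform_norm f + uniform_norm g.
Proof.
apply: uniform_norm_le => [|p Kp]; first by rewrite addr_ge0 ?uniform_norm_ge0.
by rewrite (le_trans (ler_normD _ _))// lerD ?ler_uniform_norm.
Qed.

Lemma uniform_normZ (k : R) f : uniform_norm (k *: f) = `|k| * uniform_norm f.
Proof.
have le (l : R) g : uniform_norm (l *: g) <= `|l| * uniform_norm g.
  apply: uniform_norm_le => [|p Kp]; first by rewrite mulr_ge0 ?uniform_norm_ge0.
  by rewrite [leLHS]normrM ler_wpM2l// ler_uniform_norm.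
apply/eqP; rewrite eq_le le /=.
have [->|k0] := eqVneq k 0; first by rewrite normr0 mul0r uniform_norm_ge0.
rewrite -ler_pdivlMl ?normr_gt0// -normfV.
by have := le k^-1 (k *: f); rewrite scalerA mulVf// scale1r.
Qed.

Lemma uniform_norm0_eq0 f : uniform_norm f = 0 -> f = 0.
Proof.
move=> f0; apply: crectP => p Kp; apply/eqP.
by rewrite -normr_le0 -f0 ler_uniform_norm.
Qed.

End norm_axioms.

HB.instance Definition _ a b c d := Lmodule_isNormed.Build R (crect a b c d)
  (@uniform_normD a b c d) (@uniform_normZ a b c d)
  (@uniform_norm0_eq0 a b c d).

Lemma crect_normE a b c d (f : crect a b c d) :
  `|f| = sup [set `|f p| | p in rect a b c d].
Proof. by []. Qed.

End ContinuousFunctionsOnRectangle.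

Section Operators.
Context {R : realType}.
Implicit Types V W : normedModType R.

Definition bounded_linear V W (T : V -> W) : Prop :=
  linear T /\ exists M : R, forall f, `|T f| <= M * `|f|.

(* [sup] of an unbounded set is 0: only meaningful for a bounded operator. *)
Definition opnorm V W (T : V -> W) : R :=
  sup [set `|T f| | f in [set f : V | `|f| <= 1]].

Definition bounded_below V W (T : V -> W) : Prop :=
  exists2 k : R, 0 < k & forall f, k * `|f| <= `|T f|.

Definition bounded_inverse V W (T : V -> W) (S : W -> V) : Prop :=
  [/\ bounded_linear S, cancel T S & cancel S T].

Definition topological_automorphism V (T : V -> V) : Prop :=
  bounded_linear T /\ exists S, bounded_inverse T S.

Definition point_spectrum V (T : V -> V) : set R :=
  [set lambda | exists2 f : V, f != 0 & T f = lambda *: f].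

Definition compact_operator V W (T : V -> W) : Prop :=
  precompact (T @` [set f : V | `|f| <= 1]).

Definition has_dim (E : lmodType R) (S : set E) (n : nat) : Prop :=
  exists e : 'I_n -> E,
    (forall k : 'I_n -> R, \sum_i k i *: e i = 0 -> forall i, k i = 0) /\
    S = [set \sum_i k i *: e i | k in [set: 'I_n -> R]].

Definition finite_dim (E : lmodType R) (S : set E) : Prop :=
  exists n, has_dim S n.

Definition dim (E : lmodType R) (S : set E) : nat := get (has_dim S).

Definition dual V : set (V -> R^o) := [set phi | bounded_linear phi].

Definition adjoint V W (T : V -> W) (phi : W -> R^o) : V -> R^o := phi \o T.

Definition ker V W (T : V -> W) : set V := [set f | T f = 0].

Definition ker_adjoint V W (T : V -> W) : set (W -> R^o) :=
  [set phi | dual phi /\ adjoint T phi = 0].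

Definition fredholm V W (T : V -> W) : Prop :=
  [/\ bounded_linear T, closed (range T), finite_dim (ker T)
    & finite_dim (ker_adjoint T)].

Definition fredholm_index V W (T : V -> W) : int :=
  (dim (ker T))%:Z - (dim (ker_adjoint T))%:Z.

End Operators.

Section FractalOperator.
Context {R : realType}.

Definition net (x : nat -> R) (N : nat) : Prop :=
  forall i, (i < N)%N -> x i < x i.+1.

(* the affine map sending s to s' and t to t' *)
Definition affine_map (s t s' t' z : R) : R :=
  s' + (t' - s') / (t - s) * (z - s).

Lemma affine_mapK s t s' t' : s != t -> s' != t' ->
  cancel (affine_map s t s' t') (affine_map s' t' s t).
Proof.
move=> st st' z; rewrite /affine_map [s' + _]addrC addrK mulrA.
rewrite -[(t - s) / (t' - s')]invf_div mulVf ?mul1r; first by rewrite addrC subrK.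
by rewrite mulf_neq0// ?invr_eq0 subr_eq0 eq_sym.
Qed.

Lemma affine_map_left s t s' t' : affine_map s t s' t' s = s'.
Proof. by rewrite /affine_map subrr mulr0 addr0. Qed.

Lemma affine_map_right s t s' t' : s != t -> affine_map s t s' t' t = t'.
Proof.
by move=> st; rewrite /affine_map divfK ?subr_eq0 1?eq_sym// addrC subrK.
Qed.

(* images under the i-th map of the first and of the last node *)
Definition net_first (x : nat -> R) (i : nat) : R :=
  if odd i then x i.-1 else x i.
Definition net_last (x : nat -> R) (i : nat) : R :=
  if odd i then x i else x i.-1.

Definition net_map (x : nat -> R) (N i : nat) : R -> R :=
  affine_map (x 0%N) (x N) (net_first x i) (net_last x i).
Definition net_map_inv (x : nat -> R) (N i : nat) : R -> R :=
  affine_map (net_first x i) (net_last x i) (x 0%N) (x N).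

Lemma net_lt x N i : net x N -> (0 < i <= N)%N -> x 0%N < x i.
Proof.
move=> xN; case: i => // i /=; elim: i => [|i IH] iN; first exact: xN.
by rewrite (lt_trans (IH (ltnW iN)))// xN.
Qed.

Lemma net_map_ends x N i : net x N -> (1 <= i <= N)%N ->
  x 0%N != x N /\ net_first x i != net_last x i.
Proof.
move=> xN /andP[i1 iN]; split.
  by rewrite lt_eqF// (net_lt xN)// (leq_trans i1)/=.
have xi : x i.-1 < x i by have := xN i.-1; rewrite prednK//; apply.
by rewrite /net_first /net_last; case: odd; rewrite ?(lt_eqF xi)// gt_eqF.
Qed.

Lemma net_mapK x N i : net x N -> (1 <= i <= N)%N ->
  cancel (net_map x N i) (net_map_inv x N i).
Proof. by move=> xN /(net_map_ends xN)[? ?]; exact: affine_mapK. Qed.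

Lemma net_map_invK x N i : net x N -> (1 <= i <= N)%N ->
  cancel (net_map_inv x N i) (net_map x N i).
Proof. by move=> xN /(net_map_ends xN)[? ?]; exact: affine_mapK. Qed.

Variables (x y : nat -> R) (N M : nat).
Notation C := (crect (x 0%N) (x N) (y 0%N) (y M)).
Variables (alpha : C) (L : C -> C).

Definition fractal_equation (f g : C) : Prop :=
  forall i j : nat, (1 <= i <= N)%N -> (1 <= j <= M)%N ->
  forall s t : R, s \in `[x i.-1, x i] -> t \in `[y j.-1, y j] ->
    g (s, t) = f (s, t)
      + alpha (s, t) * g (net_map_inv x N i s, net_map_inv y M j t)
      - alpha (s, t) * (L f) (net_map_inv x N i s, net_map_inv y M j t).

(* The equation has exactly one solution when |alpha| < 1: the orientations in
   [net_first] and [net_last] make it consistent on the grid lines. *)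
Definition fractal_operator (f : C) : C := get (fractal_equation f).

End FractalOperator.

(* Main.v *)
From HB Require Import structures.
Require Import Defs.
From mathcomp Require Import all_boot all_order all_algebra.
From mathcomp Require Import all_classical all_reals all_analysis.
From mathcomp Require Import lra.

(** The maps u_i and v_j alternate in orientation, so their inverses glue into
    one continuous map Q of the rectangle to itself, which folds each cell of
    the net onto the whole rectangle ([folding], built from [net_fold]).
    With A h = alpha * (h o Q), a linear operator of norm at most |alpha| < 1,
    the fractal equation reads g = f + A (g - L f) ([fractal_equationP]), that is
    (1 - A) g = (1 - A L) f. The space of continuous functions on the rectangle
    is complete ([crect_complete]), so 1 - A is invertible and the fractal
    operator is F = (1 - A)^-1 (1 - A L).

    All the assertions but one then hold for such an F on any Banach space.
    From F f - f = A (F f - f) + A (f - L f) comes the distance estimate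
    ([perturbation_dist]), and from it the bound of the norm of F and the fact
    that fixed points of L are fixed by F, which forces norm at least 1 when
    there is a nonzero one. From f = (1 - A) (F f) + A (L f) comes a lower bound
    ([perturbation_lower]) as soon as |alpha| |L| < 1. Under that same
    condition 1 - A L is invertible as well, so that F is an automorphism whose
    inverse is controlled by the lower bound ([perturbation_inverse]); the
    hypothesis |alpha| < 1 / (1 + |1 - L|) implies it because
    |L| <= 1 + |1 - L|. An automorphism is Fredholm with trivial kernels
    ([automorphism_fredholm]).

    Noncompactness is the one assertion that depends on the space: the unit
    ball contains a sequence with mutual distances at least 1/2
    ([crect_separated_sequence]), and an operator bounded below maps it to a
    separated sequence, which has no cluster point. *)

Set Implicit Arguments.
Unset Strict Implicit.
Unset Printing Implicit Defensive.

Import Order.TTheory GRing.Theory Num.Theory.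
Import numFieldNormedType.Exports.

Local Open Scope classical_set_scope.
Local Open Scope ring_scope.

(** * Operator norms, compactness and Fredholm operators *)

Section LinearMaps.
Context {R : realType}.
Implicit Types V W : normedModType R.

Lemma linear_funB V W (T : V -> W) :
  linear T -> forall f g, T (f - g) = T f - T g.
Proof.
by move=> lT f g; rewrite addrC -scaleN1r lT scaleN1r addrC.
Qed.

Lemma linear_fun0 V W (T : V -> W) : linear T -> T 0 = 0.
Proof. by move=> lT; rewrite -(subrr 0) linear_funB// subrr. Qed.

Lemma linear_funZ V W (T : V -> W) :
  linear T -> forall k f, T (k *: f) = k *: T f.
Proof.
by move=> lT k f; rewrite -[k *: f]addr0 lT linear_fun0// addr0.
Qed.

Lemma bounded_linear_idB V (T : V -> V) :
  bounded_linear T -> bounded_linear (fun f => f - T f).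
Proof.
move=> [lT [M TM]]; split=> [k f g|].
  by rewrite lT scalerBr opprD addrACA.
exists (1 + M) => f; rewrite mulrDl mul1r.
by rewrite (le_trans (ler_normB _ _))// lerD2l.
Qed.

Lemma opnorm_le V W (T : V -> W) (M : R) : 0 <= M ->
  (forall f, `|T f| <= M * `|f|) -> opnorm T <= M.
Proof.
move=> M0 TM; apply: ge_sup => [|_ [f /= f1 <-]].
  by exists `|T 0|, 0 => //=; rewrite normr0.
by rewrite (le_trans (TM f))// ler_piMr.
Qed.

Lemma ler_opnorm_unit V W (T : V -> W) f :
  bounded_linear T -> `|f| <= 1 -> `|T f| <= opnorm T.
Proof.
move=> [_ [M TM]] f1; apply: ub_le_sup; last by exists f.
exists `|M| => _ [g /= g1 <-].
rewrite (le_trans (TM g))// (le_trans (ler_wpM2r _ (ler_norm M)))//.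
by rewrite ler_piMr.
Qed.

Lemma ler_opnorm V W (T : V -> W) f :
  bounded_linear T -> `|T f| <= opnorm T * `|f|.
Proof.
move=> bT; have [lT _] := bT.
have [->|f0] := eqVneq f 0; first by rewrite linear_fun0// !normr0 mulr0.
have nf : 0 < `|f| by rewrite normr_gt0.
rewrite -ler_pdivrMr//.
have -> : `|T f| / `|f| = `|T (`|f|^-1 *: f)|.
  by rewrite linear_funZ// normrZ normfV normr_id mulrC.
apply: ler_opnorm_unit => //.
by rewrite normrZ normfV normr_id mulVf ?gt_eqF.
Qed.

Lemma opnorm_ge0 V W (T : V -> W) : bounded_linear T -> 0 <= opnorm T.
Proof.
move=> bT; rewrite (le_trans (normr_ge0 (T 0)))// ler_opnorm_unit//.
by rewrite normr0.
Qed.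

Lemma bounded_below_inj V W (T : V -> W) :
  linear T -> bounded_below T -> injective T.
Proof.
move=> lT [k k0 Tk] f g fg; apply/eqP; rewrite -subr_eq0 -normr_le0.
by rewrite -(ler_pM2l k0) mulr0 (le_trans (Tk _))// linear_funB// fg subrr normr0.
Qed.

(** A sequence in a compact set clusters at some point, so two of its terms
    are as close as one likes. *)
Lemma precompact_not_separated V (S : set V) (u : nat -> V) (e : R) :
  precompact S -> 0 < e -> (forall n, S (u n)) ->
  ~ (forall m n, (m < n)%N -> e <= `|u m - u n|).
Proof.
rewrite precompactE => cS e0 Su sep.
have e20 : 0 < e / 2 by rewrite divr_gt0.
have [|p [_ up]] := cS (u @ \oo).
  by exists 0%N => // n _; apply: subset_closure; exact: Su.
have [_ [[n _ <-] pn]] : (range u `&` ball p (e / 2)) !=set0.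
  by apply: up; [exists 0%N => // n _; exists n | exact: nbhsx_ballx].
(* The cluster point is used again, on the tail beyond [n], so as to reach a
   second index. *)
have [_ [[m /= nm <-] pm]] : (u @` [set m | (n < m)%N] `&` ball p (e / 2)) !=set0.
  by apply: up; [exists n.+1 => // m /= nm; exists m | exact: nbhsx_ballx].
have := ball_splitr pn pm; rewrite -ball_normE /= ltNge => /negP; apply.
exact: sep.
Qed.

(** An operator that is bounded below keeps a separated sequence separated. *)
Lemma bounded_below_not_compact V W (T : V -> W) (u : nat -> V) (e : R) :
  linear T -> bounded_below T -> 0 < e -> (forall n, `|u n| <= 1) ->
  (forall m n, (m < n)%N -> e <= `|u m - u n|) -> ~ compact_operator T.
Proof.
move=> lT [k k0 Tk] e0 u1 sep cT.
apply: (@precompact_not_separated _ _ (T \o u) (k * e) cT).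
- by rewrite mulr_gt0.
- by move=> n; exists (u n) => //=; exact: u1.
- move=> m n mn /=; rewrite -linear_funB//.
  by rewrite (le_trans _ (Tk _))// ler_pM2l// sep.
Qed.

Lemma has_dim_set0 (E : lmodType R) : has_dim [set 0 : E] 0.
Proof.
exists (fun=> 0); split=> [k _ []//|].
apply/seteqP; split => [_ ->|_ [k _ <-]] /=; last by rewrite big_ord0.
by exists (fun=> 0) => //; rewrite big_ord0.
Qed.

(** [dim] picks some length of a basis, so its value here rests on the zero space
    having no nonempty one: each basis vector lies in the space, so vanishes,
    against freeness. *)
Lemma dim_set0 (E : lmodType R) : Defs.dim [set 0 : E] = 0%N.
Proof.
have /getPex : exists n, has_dim [set 0 : E] n.
  by exists 0%N; exact: has_dim_set0.
rewrite -/(Defs.dim _); case: (Defs.dim _) => // n [e [free span]].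
pose k (i : 'I_n.+1) : R := (i == ord0)%:R.
have ke0 : \sum_i k i *: e i = 0.
  have : [set \sum_i k i *: e i | k in [set: 'I_n.+1 -> R]] (\sum_i k i *: e i).
    by exists k.
  by rewrite -span.
by have /eqP := free _ ke0 ord0; rewrite /k eqxx oner_eq0.
Qed.

(** A functional that vanishes on the range of a surjection is zero, so both
    kernels are trivial. *)
Lemma automorphism_fredholm V (T : V -> V) : topological_automorphism T ->
  fredholm T /\ fredholm_index T = 0.
Proof.
move=> [bT [S [_ TK SK]]]; have [lT _] := bT.
have kT : ker T = [set 0].
  apply/seteqP; split => f /=; rewrite /ker /=.
    by move=> Tf0; rewrite -(TK f) Tf0 -{1}(linear_fun0 lT) TK.
  by move=> ->; exact: linear_fun0.
have kT' : ker_adjoint T = [set 0 : V -> R^o].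
  apply/seteqP; split => [phi [_ phiT]|_ ->] /=.
    by apply/funext => g; have := congr1 (@^~ (S g)) phiT; rewrite /adjoint /= SK.
  by split=> //; split; [move=> k f g; rewrite /= scaler0 addr0 |
     exists 0 => f; rewrite normr0 mul0r].
have rT : range T = setT by apply/seteqP; split => // g _; exists (S g).
split; last by rewrite /fredholm_index kT kT' !dim_set0 subrr.
split=> //; first by rewrite rT; exact: closedT.
  by rewrite kT; exists 0%N; exact: has_dim_set0.
by rewrite kT'; exists 0%N; exact: has_dim_set0.
Qed.

End LinearMaps.

(** * The operator (1 - A)^-1 (1 - A L) on a Banach space *)

Section FractalPerturbation.
Context {R : realType} {V : completeNormedModType R}.

(** Invertibility of [1 - B] when [B] has norm less than 1, read as the
    contraction principle for [f |-> g + B f]. *)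
Lemma affine_fixed_point (B : V -> V) (q : R) (g : V) :
  linear B -> 0 <= q < 1 -> (forall f, `|B f| <= q * `|f|) ->
  exists f, f = g + B f.
Proof.
move=> lB /andP[q0 q1] Bq.
pose T : V -> V := fun f => g + B f.
have funT : set_fun setT setT T by [].
pose T' : {fun [set: V] >-> [set: V]} := HB.pack T (isFun.Build _ _ _ _ T funT).
have [|||f _ Tf] := @banach_fixed_point R V setT T'.
- exists (NngNum q0); split=> //= -[f h] _ /=.
  by rewrite /T opprD addrACA subrr add0r -linear_funB.
- exact: closedT.
- by exists 0.
- by exists f.
Qed.

(** The equation [F f = f + A (F f - L f)] is [(1 - A) F = 1 - A L]; the fractal
    operator satisfies it when [A] is composition with the folding map followed
    by multiplication by the scale function. *)
Variables (A L F : V -> V) (a : R).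
Hypotheses (a0 : 0 <= a) (a1 : a < 1) (bL : bounded_linear L).
Hypotheses (lA : linear A) (Aa : forall h, `|A h| <= a * `|h|).
Hypothesis Feq : forall f, F f = f + A (F f - L f).

Lemma perturbation_unique f g : g = f + A (g - L f) -> g = F f.
Proof.
move=> gE; apply/eqP; rewrite -subr_eq0 -normr_le0.
have : `|g - F f| <= a * `|g - F f|.
  suff {1}-> : g - F f = A (g - F f) by exact: Aa.
  rewrite {1}gE {1}Feq opprD addrACA subrr add0r -linear_funB//.
  by congr (A _); rewrite opprB addrA subrK.
by rewrite -subr_ge0 -{2}[`|_|]mul1r -mulrBl nmulr_rge0// subr_lt0.
Qed.

Lemma perturbation_linear : linear F.
Proof.
have [lL _] := bL => k f g; apply/esym/perturbation_unique.
by rewrite {1}(Feq f) {1}(Feq g) lL scalerDr [in LHS]addrACA opprD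
  [in RHS]addrACA -scalerBr lA.
Qed.

(** [F f - f = A (F f - f) + A (f - L f)], and the first term is absorbed on the
    left since [a < 1]. *)
Lemma perturbation_dist f : `|F f - f| <= a / (1 - a) * `|f - L f|.
Proof.
have a1' : 0 < 1 - a by rewrite subr_gt0.
rewrite mulrAC ler_pdivlMr// mulrBr mulr1 lerBlDr.
have {1}-> : F f - f = A (f - L f) + A (F f - f).
  rewrite {1}Feq addrC addKr -[_ + A _]addrC.
  have -> : F f - L f = 1 *: (F f - f) + (f - L f) by rewrite scale1r addrA subrK.
  by rewrite lA scale1r.
by rewrite (le_trans (ler_normD _ _))// lerD// [leRHS]mulrC.
Qed.

Lemma perturbation_norm f :
  `|F f| <= (1 + a * opnorm (fun f => f - L f) / (1 - a)) * `|f|.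
Proof.
have -> : F f = f + (F f - f) by rewrite addrC subrK.
rewrite mulrDl mul1r (le_trans (ler_normD _ _))// lerD2l.
rewrite (le_trans (perturbation_dist f))//.
rewrite [leLHS]mulrAC [leRHS]mulrAC ler_wpM2r ?invr_ge0 ?subr_ge0 ?(ltW a1)//.
rewrite -mulrA ler_wpM2l//.
exact: (@ler_opnorm _ _ _ (fun f => f - L f) f (bounded_linear_idB bL)).
Qed.

Lemma perturbation_bounded_linear : bounded_linear F.
Proof.
by split; [exact: perturbation_linear | eexists; exact: perturbation_norm].
Qed.

Lemma perturbation_opnorm :
  opnorm F <= 1 + a * opnorm (fun f => f - L f) / (1 - a).
Proof.
apply: opnorm_le; last exact: perturbation_norm.
rewrite addr_ge0// divr_ge0 ?subr_ge0 ?(ltW a1)// mulr_ge0//.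
exact/opnorm_ge0/bounded_linear_idB.
Qed.

(** Solving the equation for [f] instead, [f = (1 - A) (F f) + A (L f)], bounds
    [f] by [F f] up to a multiple of [f] that is absorbed when
    [a * opnorm L < 1]. *)
Lemma perturbation_lower f :
  (1 - a * opnorm L) * `|f| <= (1 + a) * `|F f|.
Proof.
rewrite !mulrBl !mulrDl !mul1r lerBlDr.
have {1}-> : f = F f + (A (L f) - A (F f)).
  by rewrite -[A (L f) - _]opprB -linear_funB// {1}Feq addrK.
rewrite -addrA (le_trans (ler_normD _ _))// lerD2l.
rewrite addrC (le_trans (ler_normB _ _))// lerD//.
rewrite (le_trans (Aa _))// -mulrA ler_wpM2l//; exact: ler_opnorm.
Qed.

Lemma mul_opnorm_lt1_of_inv : a < (opnorm L)^-1 -> a * opnorm L < 1.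
Proof.
have [->|L0] := eqVneq (opnorm L) 0; first by rewrite mulr0 ltr01.
by rewrite -[_^-1]mul1r ltr_pdivlMr// lt_neqAle eq_sym L0 opnorm_ge0.
Qed.

(** [L = 1 - (1 - L)], so [opnorm L <= 1 + opnorm (1 - L)]. *)
Lemma mul_opnorm_lt1_of_idB :
  a < (1 + opnorm (fun f => f - L f))^-1 -> a * opnorm L < 1.
Proof.
have bI := bounded_linear_idB bL; have I0 := opnorm_ge0 bI.
have I1 : 0 < 1 + opnorm (fun f => f - L f) by rewrite ltr_wpDr.
rewrite -{1}[_^-1]mul1r ltr_pdivlMr// => aI.
rewrite (le_lt_trans _ aI)// ler_wpM2l//; apply: opnorm_le => [|f]; first exact: ltW.
have -> : L f = f - (f - L f) by rewrite opprB addrC subrK.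
rewrite (le_trans (ler_normB _ _))// mulrDl mul1r lerD2l.
exact: (ler_opnorm f bI).
Qed.

Lemma perturbation_bounded_below : a * opnorm L < 1 -> bounded_below F.
Proof.
move=> aL; have a1' : 0 < 1 + a by rewrite ltr_wpDr.
exists ((1 - a * opnorm L) / (1 + a)) => [|f].
  by rewrite divr_gt0// subr_gt0.
by rewrite mulrAC ler_pdivrMr// [leRHS]mulrC perturbation_lower.
Qed.

(** [1 - A L] is itself invertible by the contraction principle, so [F] is onto;
    the lower bound of [F] makes it injective and bounds the inverse. *)
Lemma perturbation_inverse : a * opnorm L < 1 ->
  exists2 S, bounded_inverse F S
    & opnorm S <= (1 + a) / (1 - a * opnorm L).
Proof.
move=> aL; have [lL _] := bL; have lF := perturbation_linear.
have aL0 : 0 < 1 - a * opnorm L by rewrite subr_gt0.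
have Fsurj g : exists f, F f = g.
  (* [F f = g] amounts to [(1 - A L) f = (1 - A) g]. *)
  have [|||f fE] := @affine_fixed_point (A \o L) (a * opnorm L) (g - A g).
  - by move=> k f h /=; rewrite lL lA.
  - by rewrite aL mulr_ge0// opnorm_ge0.
  - move=> f; rewrite (le_trans (Aa _))// -mulrA ler_wpM2l//; exact: ler_opnorm.
  exists f; apply/esym/perturbation_unique.
  by rewrite {1}fE /= (linear_funB lA) addrACA subrr addr0 subrK.
have Finj : injective F.
  exact: bounded_below_inj lF (perturbation_bounded_below aL).
have [S SK] := choice Fsurj.
have FK : cancel F S by move=> f; apply: Finj; rewrite SK.
have Sle g : `|S g| <= (1 + a) / (1 - a * opnorm L) * `|g|.
  rewrite mulrAC ler_pdivlMr// mulrC.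
  by rewrite (le_trans (perturbation_lower _))// SK.
exists S; last by apply: opnorm_le => //; rewrite divr_ge0 ?(ltW aL0)// addr_ge0.
split=> //; split; last by eexists; exact: Sle.
by move=> k f g; apply: Finj; rewrite lF !SK.
Qed.

Lemma perturbation_fixed f : L f = f -> F f = f.
Proof.
move=> Lf; apply/eqP; rewrite -subr_eq0 -normr_le0.
by rewrite (le_trans (perturbation_dist f))// Lf subrr normr0 mulr0.
Qed.

Lemma perturbation_opnorm_ge1 : point_spectrum L 1 -> 1 <= opnorm F.
Proof.
move=> [f f0]; rewrite scale1r => /perturbation_fixed Ff.
rewrite -(ler_pM2r (_ : 0 < `|f|)) ?normr_gt0// mul1r -{1}Ff.
exact/ler_opnorm/perturbation_bounded_linear.
Qed.

End FractalPerturbation.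

(** * The space of continuous functions on a rectangle *)

Section Rectangle.
Context {R : realType} {a b c d : R}.
Local Notation K := (rect a b c d).
Local Notation C := (crect a b c d).

Lemma crect_linE (k : R) (f g : C) p : (k *: f + g) p = k * f p + g p.
Proof. by []. Qed.

Lemma crectDE (f g : C) p : (f + g) p = f p + g p.
Proof. by []. Qed.

Lemma crectBE (f g : C) p : (f - g) p = f p - g p.
Proof. by []. Qed.

Lemma ler_crect_norm (f : C) p : `|f p| <= `|f|.
Proof.
have [Kp|Kp] := pselect (K p); first exact: ler_uniform_norm.
by rewrite crect_out// normr0.
Qed.

Lemma crect_cvg (f : C) p : K p -> f @ within K (nbhs p) --> f p.
Proof. by move: p; apply/subspace_continuousP; exact: crect_continuous. Qed.

(** The limit is taken pointwise; the Cauchy condition makes the convergence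
    uniform, and continuity passes to uniform limits. *)
Lemma crect_complete (F : set_system C) : ProperFilter F -> cauchy F -> cvg F.
Proof.
move=> PF /cauchy_ballP cF.
have cvF (p : R * R) : cvg ((fun f : C => f p) @ F).
  apply: cauchy_cvg; apply/cauchy_ballP => e e0.
  rewrite near_map2; apply: filterS (cF e e0) => -[f h] /=.
  by rewrite -!ball_normE /=; apply: le_lt_trans; exact: (ler_crect_norm (f - h)).
pose g p := lim ((fun f : C => f p) @ F).
have Fg e : 0 < e -> \forall f \near F, forall p, `|g p - (f : C) p| <= e.
  move=> e0; have e20 : 0 < e / 2 by rewrite divr_gt0.
  near=> f => p; near F => h.
  rewrite (le_trans (ler_distD (h p) _ _))// (splitr e) lerD//.
    by near: h; move/cvgrPdist_le : (cvF p); exact.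
  rewrite distrC (le_trans (ler_crect_norm (f - h) p))// ltW//.
  have : ball f (e / 2) h by near: h; near: f; apply: nearP_dep; exact: cF.
  by rewrite -ball_normE.
have g_in : g \in crect_pred a b c d.
  apply/asboolP; split=> [|p Kp]; last first.
    apply/eqP; rewrite -normr_le0; apply/ler_addgt0Pr => e e0; rewrite add0r.
    near F => f; rewrite -[g p]subr0 -(crect_out f Kp).
    by move: (p); near: f; exact: Fg.
  apply/subspace_continuousP => p Kp; apply/cvgrPdist_le => e e0.
  have e30 : 0 < e / 3 by rewrite divr_gt0.
  near F => f.
  have fg : forall p, `|g p - f p| <= e / 3 by near: f; exact: Fg.
  have /cvgrPdist_le/(_ _ e30) := crect_cvg (f := f) Kp; apply: filterS => q fpq.
  rewrite (le_trans (ler_distD (f p) _ _))//.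
  have -> : e = e / 3 + (e / 3 + e / 3) by lra.
  rewrite lerD// (le_trans (ler_distD (f q) _ _))// lerD// distrC; exact: fg.
apply/cvg_ex; exists (CRect g_in); apply/cvgrPdist_le => e e0.
near=> f; apply: uniform_norm_le => [|p Kp]; first exact: ltW.
by move: (p); near: f; exact: Fg.
Unshelve. all: by end_near. Qed.

HB.instance Definition _ := Uniform_isComplete.Build C crect_complete.

(** Elements of [crect] vanish off the rectangle, so a function that is only
    continuous on the rectangle is first cut off there. *)
Definition cutoff (f : R * R -> R) : R * R -> R := patch (fun=> 0) K f.

Lemma cutoff_crect f : {within K, continuous f} -> cutoff f \in crect_pred a b c d.
Proof.
move=> cf; apply/asboolP; split=> [|p Kp]; last first.
  by rewrite /cutoff /patch; case: ifPn => //; rewrite inE.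
move: cf; apply: subspace_eq_continuous => p Kp.
by rewrite /from_subspace /cutoff /patch /= Kp.
Qed.

Definition crect_of f (cf : {within K, continuous f}) : C :=
  CRect (cutoff_crect cf).

Lemma crect_ofE f (cf : {within K, continuous f}) p : K p -> crect_of cf p = f p.
Proof. by move=> Kp; rewrite /= /cutoff /patch mem_set. Qed.

Section comp.
Variables (alpha : C) (Q : R * R -> R * R).
Hypotheses (cQ : continuous Q) (KQ : forall p, K p -> K (Q p)).

Lemma weighted_comp_continuous (h : C) :
  {within K, continuous (fun p => alpha p * h (Q p))}.
Proof.
apply/subspace_continuousP => p Kp; apply: cvgM.
  exact: crect_cvg.
have hQ := crect_cvg (f := h) (KQ Kp).
have QK : Q @ within K (nbhs p) --> within K (nbhs (Q p)).
  move=> U QU.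
  have cQU : nbhs p (Q @^-1` [set q | K q -> U q]) by exact: (@cQ p).
  suff : nbhs p [set q | K q -> U (Q q)] by [].
  by apply: filterS cQU => q qU Kq; exact/qU/KQ.
exact: cvg_comp QK hQ.
Qed.

Definition weighted_comp (h : C) : C := crect_of (weighted_comp_continuous (h := h)).

Lemma weighted_compE (h : C) p : K p -> weighted_comp h p = alpha p * h (Q p).
Proof. exact: crect_ofE. Qed.

Lemma weighted_comp_linear : linear weighted_comp.
Proof.
move=> k f g; apply: crectP => p Kp; rewrite crect_linE !weighted_compE//.
by rewrite crect_linE mulrDr mulrCA.
Qed.

Lemma weighted_comp_norm h : `|weighted_comp h| <= `|alpha| * `|h|.
Proof.
apply: uniform_norm_le => [|p Kp]; first by rewrite mulr_ge0.
by rewrite weighted_compE// normrM ler_pM// ler_crect_norm.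
Qed.


End comp.

(** A steepening ramp in the first coordinate, equal to 1 from the point
    [a + (b - a) / 2 ^+ n] on. *)
Definition ramp n (p : R * R) : R := Num.min 1 (2 ^+ n * ((p.1 - a) / (b - a))).

Lemma ramp_continuous n : {within K, continuous (ramp n)}.
Proof.
apply: continuous_subspaceT => p.
apply: (@continuous_min _ _ (fun=> 1) (fun p => 2 ^+ n * ((p.1 - a) / (b - a)))).
  exact: cvg_cst.
apply: cvgM; first exact: cvg_cst.
apply: cvgM; last exact: cvg_cst.
by apply: cvgB; [exact: cvg_fst | exact: cvg_cst].
Qed.

(** At the point where the [n]-th ramp first reaches 1, every earlier one is
    still at most 1/2. *)
Lemma crect_separated_sequence : a < b -> c <= d ->
  exists u : nat -> C, (forall n, `|u n| <= 1) /\
    (forall m n, (m < n)%N -> 1 / 2 <= `|u m - u n|).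
Proof.
move=> ab cd; have ab0 : 0 < b - a by rewrite subr_gt0.
have pow0 n : (0 : R) < 2 ^+ n by rewrite exprn_gt0.
exists (fun n => crect_of (ramp_continuous (n := n))); split=> [n|m n mn].
  apply: uniform_norm_le => // -[s t] Kst; rewrite crect_ofE//.
  have [/andP[as_ _] _] := Kst.
  rewrite /ramp ger0_norm ?ge_min ?lexx// le_min ler01/=.
  by rewrite mulr_ge0 ?(ltW (pow0 _))// divr_ge0 ?(ltW ab0)// subr_ge0.
pose p : R * R := (a + (b - a) / 2 ^+ n, c).
have Kp : K p.
  split; rewrite /= in_itv /= ?lexx//=.
  rewrite lerDl divr_ge0 ?(ltW ab0) ?(ltW (pow0 n))//= -lerBrDl ler_pdivrMr//.
  rewrite ler_peMr ?(ltW ab0)//.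
  by rewrite exprn_ege1// ler1n.
have pE : (p.1 - a) / (b - a) = (2 ^+ n)^-1.
  by rewrite /p /= addrC addKr mulrAC divff ?mul1r// gt_eqF.
apply: le_trans (ler_uniform_norm _ Kp).
rewrite crectBE !crect_ofE// /ramp pE divff ?gt_eqF// minxx distrC.
apply: le_trans (ler_norm _); rewrite lerBrDr -lerBrDl ge_min; apply/orP; right.
rewrite ler_pdivrMr//.
have -> : (1 - 1 / 2 : R) = 2^-1 by lra.
rewrite -(subnKC mn) exprD exprS mulrA mulrA mulVf// mul1r ler_peMr//.
by rewrite exprn_ege1// ler1n.
Qed.
End Rectangle.

(** * Folding a net onto its whole interval *)

Section Fold.
Context {R : realType}.
Implicit Types (x : nat -> R) (N n i : nat).

(** The inverses of the affine maps of a net, glued together over its first [n]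
    intervals. Clamping the argument at [x m] on each side turns the gluing
    into a sum of globally continuous functions: left of [x m] only the first
    term varies, right of it only the difference does. *)
Fixpoint net_fold x N n (s : R) : R :=
  if n is m.+1 then
    net_fold x N m (Num.min s (x m))
      + (net_map_inv x N m.+1 (Num.max s (x m)) - net_map_inv x N m.+1 (x m))
  else x 0%N.

Lemma affine_map_continuous (s t s' t' : R) : continuous (affine_map s t s' t').
Proof.
move=> z; apply: cvgD; first exact: cvg_cst.
by apply: cvgM; [exact: cvg_cst | apply: cvgB; [exact: cvg_id | exact: cvg_cst]].
Qed.

Lemma affine_map_itv (s t s' t' z : R) : s' <= t' ->
  s < t /\ s <= z <= t \/ t < s /\ t <= z <= s ->
  affine_map s t s' t' z \in `[s', t'].
Proof.
move=> st' zst; rewrite /affine_map -mulrA [_^-1 * _]mulrC.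
have /andP[r0 r1] : 0 <= (z - s) / (t - s) <= 1.
  case: zst => -[st /andP[z1 z2]].
    by rewrite divr_ge0 ?subr_ge0 ?(ltW st)//= ler_pdivrMr ?subr_gt0// mul1r lerB.
  rewrite -[(z - s) / _]mulrNN -invrN !opprB.
  by rewrite divr_ge0 ?subr_ge0 ?(ltW st)//= ler_pdivrMr ?subr_gt0// mul1r lerB.
have t0 : 0 <= t' - s' by rewrite subr_ge0.
by rewrite in_itv /= lerDl mulr_ge0//= -lerBrDl ler_piMr.
Qed.

Lemma net_map_inv_itv x N i s : net x N -> (1 <= i <= N)%N ->
  s \in `[x i.-1, x i] -> net_map_inv x N i s \in `[x 0%N, x N].
Proof.
move=> xN iN; rewrite in_itv /= => si.
have x0N : x 0%N < x N.
  by apply: (net_lt xN); move: iN => /andP[i1 iN]; rewrite (leq_trans i1)/=.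
have xi : x i.-1 < x i.
  by move: iN => /andP[i1 iN]; have := xN i.-1; rewrite prednK//; apply.
apply: affine_map_itv; first exact: ltW.
by rewrite /net_first /net_last; case: odd; [left | right].
Qed.

Lemma net_le x N i n : net x N -> (i <= n <= N)%N -> x i <= x n.
Proof.
move=> xN /andP[]; elim: n => [|n IH]; first by rewrite leqn0 => /eqP ->.
rewrite leq_eqVlt => /orP[/eqP -> //|] /[!ltnS] ni nN.
by rewrite (le_trans (IH ni (ltnW nN)))// ltW// xN.
Qed.

Lemma net_cover x N s : net x N -> (0 < N)%N -> s \in `[x 0%N, x N] ->
  exists2 i, (1 <= i <= N)%N & s \in `[x i.-1, x i].
Proof.
move=> + N0; rewrite -(prednK N0); elim: N.-1 => [|n IH] xN sN.
  by exists 1%N.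
have [sn|ns] := leP s (x n.+1).
  have [||i /andP[i1 iN] si] := IH.
  - by move=> i iN; apply: xN; rewrite ltnW.
  - by move: sN; rewrite !in_itv /= sn => /andP[->].
  by exists i => //; rewrite i1 leqW.
by exists n.+2; rewrite /= ?leqnn//; move: sN; rewrite !in_itv /= (ltW ns) => /andP[].
Qed.

(** This lemma and the next one show that the inverse maps of two consecutive
    intervals agree at their common node: this is what the alternating
    orientations are for. *)
Lemma net_map_inv_pred x N n : net x N -> (n < N)%N ->
  net_map_inv x N n.+1 (x n) = if odd n then x N else x 0%N.
Proof.
move=> xN nN; have [|_] := net_map_ends (i := n.+1) xN; first by rewrite /= nN.
rewrite /net_map_inv /net_first /net_last /=; case: odd => /= st.
  exact: affine_map_right.
exact: affine_map_left.
Qed.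

Lemma net_map_inv_node x N n : net x N -> (n < N)%N ->
  net_map_inv x N n.+1 (x n.+1) = if odd n.+1 then x N else x 0%N.
Proof.
move=> xN nN; have [|_] := net_map_ends (i := n.+1) xN; first by rewrite /= nN.
rewrite /net_map_inv /net_first /net_last /=; case: odd => /= st.
  exact: affine_map_left.
exact: affine_map_right.
Qed.

Lemma net_fold_continuous x N n : continuous (net_fold x N n).
Proof.
elim: n => [|n IH] s /=; first exact: cvg_cst.
apply: cvgD.
  apply: (@continuous_comp _ _ _ (fun s => Num.min s (x n))); last exact: IH.
  by apply: (@continuous_min _ _ id (fun=> x n)); [exact: cvg_id | exact: cvg_cst].
apply: cvgB; last exact: cvg_cst.
apply: (@continuous_comp _ _ _ (fun s => Num.max s (x n))).
  by apply: (@continuous_max _ _ id (fun=> x n)); [exact: cvg_id | exact: cvg_cst].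
exact: affine_map_continuous.
Qed.

Lemma net_fold_node x N n : net x N -> (n <= N)%N ->
  net_fold x N n (x n) = if odd n then x N else x 0%N.
Proof.
move=> xN; elim: n => [//|n IH] nN.
have xn : x n <= x n.+1 by rewrite ltW// xN.
rewrite -net_map_inv_node//= min_r// max_l// IH ?(ltnW nN)//.
by rewrite -net_map_inv_pred// addrC subrK.
Qed.

Lemma net_foldE x N n i s : net x N -> (1 <= i <= n)%N -> (n <= N)%N ->
  s \in `[x i.-1, x i] -> net_fold x N n s = net_map_inv x N i s.
Proof.
move=> xN; elim: n => [|n IH] /andP[i1]; first by case: i i1.
rewrite leq_eqVlt ltnS => /orP[/eqP -> | iln] nN; rewrite in_itv /= => /andP[s1 s2].
  by rewrite min_r// max_l// net_fold_node ?(ltnW nN)// -net_map_inv_pred// addrC subrK.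
have sn : s <= x n by rewrite (le_trans s2)// (net_le xN)// iln ltnW.
rewrite min_l// max_r// subrr addr0 IH ?i1 ?iln ?(ltnW nN)//.
by rewrite in_itv /= s1.
Qed.

Lemma net_fold_itv x N s : net x N -> (0 < N)%N -> s \in `[x 0%N, x N] ->
  net_fold x N N s \in `[x 0%N, x N].
Proof.
move=> xN N0 /(net_cover xN N0)[i iN si].
by rewrite (net_foldE xN iN)// net_map_inv_itv.
Qed.

End Fold.

(** * The fractal operator *)

Section FractalOperatorTheory.
Context {R : realType}.
Variables (x y : nat -> R) (N M : nat).
Hypotheses (hx : net x N) (hy : net y M) (N0 : (0 < N)%N) (M0 : (0 < M)%N).
Local Notation C := (crect (x 0%N) (x N) (y 0%N) (y M)).
Local Notation K := (rect (x 0%N) (x N) (y 0%N) (y M)).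
Variables (alpha : C) (L : C -> C).

Definition folding (p : R * R) : R * R := (net_fold x N N p.1, net_fold y M M p.2).

Lemma folding_continuous : continuous folding.
Proof.
move=> p.
have c1 : net_fold x N N q.1 @[q --> p] --> net_fold x N N p.1.
  apply: cvg_comp; first exact: cvg_fst.
  exact: net_fold_continuous.
have c2 : net_fold y M M q.2 @[q --> p] --> net_fold y M M p.2.
  apply: cvg_comp; first exact: cvg_snd.
  exact: net_fold_continuous.
exact: (cvg_pair c1 c2).
Qed.

Lemma folding_rect p : K p -> K (folding p).
Proof. by move=> [p1 p2]; split; exact: net_fold_itv. Qed.

Let A := weighted_comp alpha folding_continuous folding_rect.

(** The intervals of the two nets cover the rectangle, so the equations on its
    cells make up a single equation between continuous functions. *)
Lemma fractal_equationP (f g : C) :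
  fractal_equation alpha L f g <-> g = f + A (g - L f).
Proof.
split=> [gE|gE i j iN jM s t si tj].
  apply: crectP => -[s t] Kst; have [sI tJ] := Kst.
  have [i iN si] := net_cover (s := s) hx N0 sI.
  have [j jM tj] := net_cover (s := t) hy M0 tJ.
  rewrite crectDE weighted_compE// crectBE mulrBr addrA /folding.
  by rewrite (net_foldE (s := s) hx iN)// (net_foldE (s := t) hy jM)//; exact: gE.
have Kst : K (s, t).
  move: (iN) (jM) => /andP[_ iN'] /andP[_ jM'].
  split; rewrite /= in_itv /=.
    move: si; rewrite in_itv /= => /andP[s1 s2].
    rewrite (le_trans _ s1) ?(le_trans s2)// (net_le hx)//.
      by rewrite iN' leqnn.
    by rewrite (leq_trans (leq_pred _)).
  move: tj; rewrite in_itv /= => /andP[s1 s2].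
  rewrite (le_trans _ s1) ?(le_trans s2)// (net_le hy)//.
    by rewrite jM' leqnn.
  by rewrite (leq_trans (leq_pred _)).
rewrite {1}gE crectDE weighted_compE// crectBE mulrBr addrA /folding.
by rewrite (net_foldE (s := s) hx iN)// (net_foldE (s := t) hy jM).
Qed.

(** Multiplying by [alpha] after composing has norm at most [`|alpha|], so the
    contraction principle solves the fractal equation. *)
Lemma fractal_operatorE : `|alpha| < 1 -> bounded_linear L ->
  forall f, fractal_operator alpha L f = f + A (fractal_operator alpha L f - L f).
Proof.
move=> alpha1 [lL _] f; apply: (fractal_equationP _ _).1; apply: getPex.
have lA : linear A by exact: weighted_comp_linear.
have [|||g gE] := @affine_fixed_point R C A `|alpha| (f - A (L f)).
- exact: lA.
- by rewrite normr_ge0.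
- exact: weighted_comp_norm.
exists g; apply: (fractal_equationP _ _).2.
by rewrite {1}gE (linear_funB lA) addrA addrAC.
Qed.

End FractalOperatorTheory.

Theorem theorem3p10 (R : realType) (N M : nat) (x y : nat -> R)
    (hN : (2 <= N)%N) (hM : (2 <= M)%N) (hx : net x N) (hy : net y M)
    (alpha : crect (x 0%N) (x N) (y 0%N) (y M)) (halpha : `|alpha| < 1)
    (L : crect (x 0%N) (x N) (y 0%N) (y M) -> crect (x 0%N) (x N) (y 0%N) (y M))
    (hL : bounded_linear L) (hLid : L <> id)
    (hLcorner : forall f i j, i \in [:: 0%N; N] -> j \in [:: 0%N; M] ->
       L f (x i, y j) = f (x i, y j)) :
  let F := fractal_operator alpha L in
  let IdL := fun f => f - L f in
  ((forall f, `|F f - f| <= `|alpha| / (1 - `|alpha|) * `|f - L f|) /\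
      (alpha = 0 -> F = id)) /\
  (bounded_linear F /\
      opnorm F <= 1 + `|alpha| * opnorm IdL / (1 - `|alpha|)) /\
  (`|alpha| < (opnorm L)^-1 -> bounded_below F /\ injective F) /\
  (`|alpha| < (1 + opnorm IdL)^-1 ->
      topological_automorphism F /\
      (exists2 S, bounded_inverse F S
         & opnorm S <= (1 + `|alpha|) / (1 - `|alpha| * opnorm L))) /\
  (`|alpha| <> 0 -> forall f, L f = f -> F f = f) /\
  (point_spectrum L 1 -> 1 <= opnorm F) /\
  (`|alpha| < (opnorm L)^-1 -> ~ compact_operator F) /\
  (`|alpha| < (1 + opnorm IdL)^-1 -> fredholm F /\ fredholm_index F = 0).
Proof.
move=> F IdL.
have N0 : (0 < N)%N by exact: ltnW.
have M0 : (0 < M)%N by exact: ltnW.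
pose A := weighted_comp alpha (folding_continuous (x := x) (y := y) (N := N) (M := M))
  (folding_rect hx hy N0 M0).
have lA : linear A by exact: weighted_comp_linear.
have Aa h : `|A h| <= `|alpha| * `|h| by exact: weighted_comp_norm.
have FE : forall f, F f = f + A (F f - L f) by exact: fractal_operatorE.
have a0 : 0 <= `|alpha| by [].
have FL := perturbation_bounded_linear a0 halpha hL lA Aa FE.
have [lF _] := FL.
have Fdist := perturbation_dist halpha lA Aa FE.
have Fbelow : `|alpha| * opnorm L < 1 -> bounded_below F.
  exact: perturbation_bounded_below.
have Finv aL := perturbation_inverse a0 halpha hL lA Aa FE aL.
have Fauto : `|alpha| * opnorm L < 1 -> topological_automorphism F.
  by move=> /Finv[S SF _]; split=> //; exists S.
split; [split=> // alpha0|split; [split=> //|split; [|split; [|split; [|split; [|split]]]]]].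
- apply/funext => f; apply/eqP; rewrite -subr_eq0 -normr_le0.
  by rewrite (le_trans (Fdist f))// alpha0 normr0 !mul0r.
- exact: perturbation_opnorm.
- move=> /(mul_opnorm_lt1_of_inv hL)/Fbelow bF; split=> //.
  exact: bounded_below_inj bF.
- move=> /(mul_opnorm_lt1_of_idB a0 hL) aL; split; first exact: Fauto.
  exact: Finv.
- by move=> _ f; exact: (perturbation_fixed halpha lA Aa FE).
- exact: (perturbation_opnorm_ge1 a0 halpha hL lA Aa FE).
- move=> /(mul_opnorm_lt1_of_inv hL)/Fbelow bF.
  have x0N : x 0%N < x N by apply: (net_lt hx); rewrite N0 /=.
  have y0M : y 0%N < y M by apply: (net_lt hy); rewrite M0 /=.
  have [u [u1 usep]] := crect_separated_sequence x0N (ltW y0M).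
  by apply: bounded_below_not_compact bF _ u1 usep.
- move=> /(mul_opnorm_lt1_of_idB a0 hL)/Fauto; exact: automorphism_fredholm.
Qed.
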